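(* There exists a constant $C\in(0,\infty)$ such that for every integer $d\geq 2$ and all $k,n\in\mathbb{N}$ with $k<n/2$, we have $$ k\text{-}\mathrm{disp}^*(n,d) \;\le\; C\,\max\left\{\log_2 (n)\sqrt{\frac{\log_2 (d)}{n}},\; k\,\frac{\log_2(n/k)}{n}\right\}. $$
   Context: $\mathbb{N}=\{1,2,3,\dots\}$. Let $d,n\in\mathbb{N}$ and $k\in\mathbb{N}\cup\{0\}$. Let $\mathscr{B}^d_{\mathrm{ax}}$ denote the collection of all axis-parallel boxes inside the $d$-dimensional cube $[0,1]^d$, i.e. all sets $\mathbb{B}=I_1\times\dots\times I_d\subset[0,1]^d$ where each $I_\ell\subset[0,1]$ is an interval. Let $\mathrm{vol}_d$ denote $d$-dimensional Lebesgue measure and $\#$ the cardinality of a set. For a point set $\mathscr{P}_n=\{x_1,\dots,x_n\}\subset[0,1]^d$ of cardinality $n$, the $k$-dispersion is $$ k\text{-}\mathrm{disp}(\mathscr{P}_n,d) := \sup\Big\{\mathrm{vol}_d(\mathbb{B})\,:\, \mathbb{B}\in\mathscr{B}^d_{\mathrm{ax}} \text{ with } \#(\mathscr{P}_n\cap\mathbb{B})\le k\Big\}. $$ The minimal $k$-dispersion is $$ k\text{-}\mathrm{disp}^*(n,d) := \inf_{\substack{\mathscr{P}_n\subset[0,1]^d\\ \#\mathscr{P}_n=n}} k\text{-}\mathrm{disp}(\mathscr{P}_n,d). $$ *)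

(* Defs.v *)
From HB Require Import structures.
From mathcomp Require Import all_boot all_order all_algebra.
From mathcomp Require Import all_classical all_reals all_analysis.
Set Implicit Arguments.
Unset Strict Implicit.
Unset Printing Implicit Defensive.
Import Order.TTheory GRing.Theory Num.Theory.
Import numFieldNormedType.Exports.
Local Open Scope classical_set_scope.
Local Open Scope ring_scope.

Definition log2 (R : realType) (x : R) : R := ln x / ln 2.

(* Points of R^d are d-tuples. The d-dimensional Lebesgue measure is the
   iterated product measure, transported along (x, y) |-> x :: y; in dimension
   0 it is the Dirac mass at the unique point. *)
Fixpoint vol (R : realType) (d : nat) :
    set (d.-tuple (measurableTypeR R)) -> \bar R :=
  match d with
  | 0 => dirac [tuple]
  | d'.+1 => pushforward (lebesgue_measure \x @vol R d')%E
               (fun p : measurableTypeR R * d'.-tuple (measurableTypeR R) =>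
                  [tuple of p.1 :: p.2])
  end.

Section vol_measure.
Variable R : realType.

Local Notation rT := (measurableTypeR R).

Let tcons (d : nat) (p : rT * d.-tuple rT) : d.+1.-tuple rT :=
  [tuple of p.1 :: p.2].

Let measurable_tcons d : measurable_fun [set: rT * d.-tuple rT] (@tcons d).
Proof. exact: measurable_cons. Qed.

Let bundle disp (T : measurableType disp) (p : set T -> \bar R) :
  p set0 = 0%E -> (forall A, (0 <= p A)%E) -> semi_sigma_additive p ->
  sigma_finite setT p ->
  exists m : {sigma_finite_measure set T -> \bar R}, m = p :> (_ -> _).
Proof.
move=> p0 p_ge0 p_sigma p_sf.
pose M := isMeasure.Build _ _ _ p p0 p_ge0 p_sigma.
pose pm : {measure set T -> \bar R} := HB.pack p M.
pose S := Measure_isSigmaFinite.Build _ _ _ pm p_sf.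
by exists (HB.pack_for {sigma_finite_measure set T -> \bar R} p pm S).
Qed.

Let vol_sigma_finite_measure (d : nat) :
  exists m : {sigma_finite_measure set (d.-tuple rT) -> \bar R},
    m = @vol R d :> (_ -> _).
Proof.
elim: d => [|d [m mE]].
  by exists (dirac ([tuple] : 0.-tuple rT)).
pose p := pushforward (lebesgue_measure \x m)%E (@tcons d).
have p0 : p set0 = 0%E.
  by rewrite /p /pushforward preimage_set0; exact: measure0.
have mtc A : measurable A -> measurable (@tcons d @^-1` A).
  by move=> mA; rewrite -[X in measurable X]setTI; exact: measurable_tcons.
have p_ge0 A : (0 <= p A)%E.
  by rewrite /p /pushforward; exact: (measure_ge0 (lebesgue_measure \x m)%E).
have p_sigma : semi_sigma_additive p.
  move=> F mF tF mUF; rewrite /p /pushforward preimage_bigcup.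
  apply: measure_semi_sigma_additive.
  - by move=> n; exact: mtc.
  - apply/trivIsetP => /= i j _ _ ij; rewrite -preimage_setI.
    by move/trivIsetP : tF => /(_ _ _ _ _ ij) ->//; rewrite preimage_set0.
  - by rewrite -preimage_bigcup; exact: mtc.
have p_sf : sigma_finite setT p.
  have /sigma_finiteP[F [FT ndF Foo]] := sigma_finiteT (@lebesgue_measure R).
  have /sigma_finiteP[G [GT ndG Goo]] := sigma_finiteT m.
  pose H n := [set t : d.+1.-tuple rT |
    (F n `*` G n) (thead t, [tuple of behead t])].
  have HE n : @tcons d @^-1` H n = F n `*` G n.
    have tK q : (thead (@tcons d q), [tuple of behead (@tcons d q)]) = q.
      by case: q => x t; congr pair; exact: val_inj.
    by apply/seteqP; split=> q; rewrite /H /preimage /mkset tK.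
  exists H.
    apply/esym/seteqP; split=> // t _.
    have : [set: rT] (thead t) by []. rewrite FT => -[n _ Fn].
    have : [set: d.-tuple rT] [tuple of behead t] by [].
    rewrite GT => -[k _ Gk].
    exists (maxn n k) => //; split => /=.
      by move: Fn; exact/subsetPset/ndF/leq_maxl.
    by move: Gk; exact/subsetPset/ndG/leq_maxr.
  move=> n; have [mF oF] := Foo n; have [mG oG] := Goo n; split.
    rewrite (_ : H n = ((fun t => tnth t ord0) @^-1` F n) `&`
      ((fun t : d.+1.-tuple rT => [tuple of behead t]) @^-1` G n))//.
    apply: measurableI; rewrite -[X in measurable X]setTI.
      exact: measurable_tnth.
    exact: measurable_behead.
  rewrite /p /pushforward HE product_measure1E// lte_mul_pinfty//.
  by rewrite ge0_fin_numE.
have [ps psE] := bundle p0 p_ge0 p_sigma p_sf.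
by exists ps; rewrite psE /p mE.
Qed.

Variable d : nat.

Let vol0 : @vol R d set0 = 0%E.
Proof. by have [m <-] := vol_sigma_finite_measure d; exact: measure0. Qed.

Let vol_ge0 A : (0 <= @vol R d A)%E.
Proof. by have [m <-] := vol_sigma_finite_measure d; exact: measure_ge0. Qed.

Let vol_sigma_additive : semi_sigma_additive (@vol R d).
Proof.
have [m <-] := vol_sigma_finite_measure d.
exact: measure_semi_sigma_additive.
Qed.

HB.instance Definition _ := isMeasure.Build _ _ _ (@vol R d)
  vol0 vol_ge0 vol_sigma_additive.

Let vol_sigma_finite : sigma_finite setT (@vol R d).
Proof. by have [m <-] := vol_sigma_finite_measure d; exact: sigma_finiteT. Qed.

HB.instance Definition _ := Measure_isSigmaFinite.Build _ _ _ (@vol R d)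
  vol_sigma_finite.

End vol_measure.

Definition cube (R : realType) (d : nat) : set (d.-tuple R) :=
  [set x | forall l : 'I_d, 0 <= tnth x l <= 1].

Definition box (R : realType) (d : nat) (I : 'I_d -> set R) :
    set (d.-tuple R) :=
  [set x | forall l : 'I_d, I l (tnth x l)].

(* [is_interval] is order-convexity, so open, closed, half-open, degenerate and
   empty intervals are all allowed. *)
Definition axis_boxes (R : realType) (d : nat) : set (set (d.-tuple R)) :=
  [set box I | I in [set I : 'I_d -> set R |
     forall l, is_interval (I l) /\ I l `<=` `[0, 1]]].

Definition kdisp (R : realType) (k d : nat) (P : set (d.-tuple R)) : \bar R :=
  ereal_sup [set vol B | B in
    [set B | axis_boxes B /\ (P `&` B #<= `I_k)%card]].

Definition min_kdisp (R : realType) (k n d : nat) : \bar R :=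
  ereal_inf [set kdisp k P | P in
    [set P : set (d.-tuple R) | P `<=` @cube R d /\ (P #= `I_n)%card]].

Lemma measurable_box (R : realType) (d : nat) (I : 'I_d -> set R) :
  (forall l, measurable (I l)) -> measurable (box I).
Proof.
move=> mI.
have -> : box I = \bigcap_l ((fun x : d.-tuple (measurableTypeR R) =>
    tnth x l) @^-1` I l).
  by apply/seteqP; split=> x h l; [move=> _|]; exact: h.
apply: fin_bigcap_measurable => // l _; rewrite -[X in measurable X]setTI.
exact: measurable_tnth.
Qed.

Lemma vol_box (R : realType) (d : nat) (I : 'I_d -> set R) :
  (forall l, measurable (I l)) ->
  vol (box I) = (\prod_(l < d) lebesgue_measure (I l))%E.
Proof.
elim: d I => [|d IHd] I mI.
  by rewrite big_ord0 /= diracE mem_set// => -[].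
rewrite big_ord_recl -IHd; last by move=> l; exact: mI.
rewrite -product_measure1E; [|exact: mI|
  by apply: measurable_box => l; exact: mI].
rewrite [LHS]/= /pushforward; congr (_ _).
apply/seteqP; split=> -[x t] /=.
  move=> tI; split=> [|l]; first by have := tI ord0; rewrite tnth0.
  by have := tI (lift ord0 l); rewrite tnthS.
move=> [xI tI] l; case: (unliftP ord0 l) => [j ->|->].
  by rewrite tnthS; exact: tI.
by rewrite tnth0.
Qed.

(* Main.v *)
Require Import Defs.
From mathcomp Require Import all_boot all_order all_algebra.
From mathcomp Require Import all_classical all_reals all_analysis.
From mathcomp Require Import zify ring lra.
Import Order.TTheory GRing.Theory Num.Theory.
Local Open Scope ring_scope.

(** Put [N ~ 4 / eps] equal cells inside each edge of the cube, leaving one cell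
    free at either end, and draw [n] of the resulting [N ^ d] grid cells at
    random.  An interval of length [u] contains at least
    [u (N + 2) - 2 = u N - 2 (1 - u)] grid cells, so a box of volume [V > eps]
    contains a fraction at least [V - (2 / N) (1 - V) >= eps / 2] of the grid,
    uniformly in [d].  Such a grid box is a full slab in all but
    [N ln (2 / eps)] coordinates, so there are few of them, and a union bound
    based on Markov's inequality for [2 ^ - (number of points in the box)] gives
    a sample with more than [k] points in each. *)

(** * Random sampling and the union bound *)

(** Suppose every [g] fails at some large [B j]. The sum over large [j] of [2 ^ k] times
    [2 ^ -(number of hits)] is then at least 1 for each [g]. Summed over all [g], the weight of one
    [j] factors over the draws and is at most [(#|T| (1 - p / 2)) ^ n], which contradicts the
    smallness assumption. *)
Lemma exists_rich_sample (R : realFieldType) (T J : finType) (B : J -> pred T)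
    (p : R) (n k : nat) :
  (0 < #|T|)%N -> #|J|%:R * 2 ^+ k * (1 - p / 2) ^+ n < 1 ->
  exists g : {ffun 'I_n -> T}, forall j, p * #|T|%:R <= #|B j|%:R ->
    (k < #|[pred i | B j (g i)]|)%N.
Proof.
move=> T0 small.
pose good j := p * #|T|%:R <= #|B j|%:R :> R.
have [/existsP[g /forallP gP]|] := boolP [exists g : {ffun 'I_n -> T},
    [forall j, good j ==> (k < #|[pred i | B j (g i)]|)%N]].
  by exists g => j jgood; exact: (implyP (gP j)).
rewrite negb_exists => /forallP bad; exfalso.
pose w (b : bool) : R := if b then 2^-1 else 1.
have wE j (g : {ffun 'I_n -> T}) :
    \prod_i w (B j (g i)) = 2^-1 ^+ #|[pred i | B j (g i)]|.
  rewrite /w -big_mkcond /= prodr_const; congr (_ ^+ _).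
have weight j : good j ->
    \sum_(g : {ffun 'I_n -> T}) \prod_i w (B j (g i)) <=
    (#|T|%:R * (1 - p / 2)) ^+ n.
  move=> jgood.
  rewrite -(bigA_distr_bigA (fun _ x => w (B j x))) prodr_const card_ord.
  have -> : \sum_x w (B j x) = #|T|%:R - #|B j|%:R / 2.
    rewrite (bigID (B j)) /= (eq_bigr (fun=> 2^-1)); last first.
      by move=> x; rewrite /w => ->.
    rewrite [X in _ + X](eq_bigr (fun=> 1)); last first.
      by move=> x; rewrite /w => /negbTE ->.
    have -> : #|T|%:R = #|B j|%:R + #|[predC B j]|%:R :> R.
      by rewrite -natrD cardC.
    rewrite !sumr_const -(mulr_natr (2^-1 : R)).
    by rewrite [LHS]addrC [#|[pred x | _]|](_ : _ = #|[predC B j]|)//; lra.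
  have Tge : #|B j|%:R <= #|T|%:R :> R by rewrite ler_nat max_card.
  have B0 : 0 <= #|B j|%:R :> R by [].
  rewrite /good in jgood; apply: lerXn2r; rewrite ?nnegrE; nra.
have Tn0 : 0 < #|T|%:R ^+ n :> R by rewrite exprn_gt0 ?ltr0n.
move: small; rewrite -(ltr_pM2l Tn0) mulr1 ltNge => /negP; apply.
rewrite [leLHS](_ : _ = \sum_(g : {ffun 'I_n -> T}) 1); last first.
  by rewrite sumr_const card_ffun card_ord natrX.
have le1 (g : {ffun 'I_n -> T}) :
    1 <= \sum_(j | good j) 2 ^+ k * \prod_i w (B j (g i)).
  have := bad g; rewrite negb_forall => /existsP[j].
  rewrite negb_imply -leqNgt => /andP[jgood jk].
  rewrite (bigD1 j)//= wE exprVn -[leLHS]addr0 lerD//.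
    by rewrite ler_pdivlMr ?exprn_gt0// mul1r ler_eXn2l// ltr1n.
  apply: sumr_ge0 => i _; rewrite mulr_ge0 ?exprn_ge0// prodr_ge0// => l _.
  by rewrite /w; case: ifP.
apply: le_trans (ler_sum _ (fun g _ => le1 g)) _.
rewrite exchange_big /=.
apply: (@le_trans _ _
    (\sum_(j | good j) 2 ^+ k * (#|T|%:R * (1 - p / 2)) ^+ n)).
  by apply: ler_sum => j jgood; rewrite -mulr_sumr ler_pM2l ?exprn_gt0 ?weight.
(* A good [j0] is needed to extend the sum to all of [J]: it forces [p <= 1], so the common bound is
   nonnegative. Without one, [le1] would read [1 <= 0]. *)
have [j0 j0good|nogood] := pickP good; last first.
  have /card_gt0P[x _] := T0.
  have := le1 [ffun=> x].
  by rewrite [X in 1 <= X -> _]big_pred0 ?ler10.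
have c0 : 0 <= 2 ^+ k * (#|T|%:R * (1 - p / 2)) ^+ n.
  rewrite mulr_ge0 ?exprn_ge0//.
  have Tge : #|B j0|%:R <= #|T|%:R :> R by rewrite ler_nat max_card.
  have Tpos : 0 < #|T|%:R :> R by rewrite ltr0n.
  by move: j0good; rewrite /good; nra.
rewrite sumr_const -[leLHS]mulr_natl.
apply: (@le_trans _ _ (#|J|%:R * (2 ^+ k * (#|T|%:R * (1 - p / 2)) ^+ n))).
  by rewrite ler_wpM2r// ler_nat max_card.
rewrite exprMn le_eqVlt; apply/orP; left; apply/eqP; ring.
Qed.

(** * Discretisation of products and intervals *)

(* The bound is stable under products because
   [1 - a b - (a (1 - b) + b (1 - a)) = (1 - a) (1 - b) >= 0]. *)
Lemma prod_shrink_ge (R : realFieldType) (I : finType) (t : R) (u q : I -> R) :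
  0 <= t -> (forall i, 0 <= u i <= 1) -> (forall i, 0 <= q i) ->
  (forall i, u i - t * (1 - u i) <= q i) ->
  \prod_i u i - t * (1 - \prod_i u i) <= \prod_i q i.
Proof.
move=> t0 u01 q0 uq.
suff [] : [/\ 0 <= \prod_i u i, \prod_i u i <= 1, 0 <= \prod_i q i &
  \prod_i u i - t * (1 - \prod_i u i) <= \prod_i q i] by [].
elim/(@big_rec2 R R): _ => [|i Q U _ [U0 U1 Q0 UQ]]; first by split; lra.
have /andP[a0 a1] := u01 i; have := q0 i; have := uq i.
move: (u i) (q i) a0 a1 => a b a0 a1 ab b0.
split; [exact: mulr_ge0|nra|exact: mulr_ge0|].
(* Lower bounds multiply only when both are nonnegative. Since [x - t * (1 - x)] increases with [x]
   and [a * U] is below [a] and [U], a negative factor makes the target bound negative too. *)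
have [neg|pos] := ltP (U - t * (1 - U)) 0.
  apply: le_trans (mulr_ge0 b0 Q0).
  have : a * U <= U by nra.
  nra.
have [neg|pos'] := ltP (a - t * (1 - a)) 0.
  apply: le_trans (mulr_ge0 b0 Q0).
  have : a * U <= a by nra.
  nra.
have m := ler_pM pos' pos ab UQ.
apply: le_trans m.
have : 0 <= t * (1 - a) * (1 - U) by rewrite !mulr_ge0// subr_ge0.
have : 0 <= t * t * ((1 - a) * (1 - U)) by rewrite !mulr_ge0// subr_ge0.
nra.
Qed.

(* Grid cells are numbered [0, ..., N - 1]; grid cell [g] is the cell
   [[(g + 1) / (N + 2), (g + 2) / (N + 2)[] of the unit interval.  The slab [s]
   consists of the grid cells lying strictly between the cells [s.1] and [s.2]
   in the numbering [0, ..., N + 1] of all cells. *)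
Definition slab (N : nat) (s : 'I_N.+2 * 'I_N.+2) : pred 'I_N :=
  [pred g : 'I_N | (s.1 <= g)%N && (g.+1 < s.2)%N].

Lemma card_slab_ge N (s : 'I_N.+2 * 'I_N.+2) : (s.2.-1 - s.1 <= #|slab N s|)%N.
Proof.
have sN (i : 'I_(s.2.-1 - s.1)) : (s.1 + i < N)%N.
  by have := ltn_ord i; have := ltn_ord s.2; lia.
have f_inj : injective (fun i => Ordinal (sN i)).
  by move=> i j /(congr1 val) /= /addnI /val_inj.
rewrite -[leqLHS]card_ord -(card_codom f_inj); apply: subset_leq_card.
apply/fintype.subsetP => _ /codomP[i ->]; rewrite inE /=.
by have := ltn_ord i; lia.
Qed.

(* [minn] puts the endpoint [x = 1] into the last cell. *)
Definition cell_index (R : realType) (N : nat) (x : R) : 'I_N.+2 :=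
  inord (minn (Num.truncn (x * N.+2%:R)) N.+1).

(** The restriction [b <= N.+1] is due to [x = 1], which has index [N.+1] although [x * N.+2%:R]
    reaches [N.+2]. *)
Lemma cell_indexP (R : realType) (N : nat) (x : R) : 0 <= x <= 1 ->
  [/\ (cell_index R N x)%:R <= x * N.+2%:R,
      x * N.+2%:R <= (cell_index R N x).+1%:R &
      forall b : nat, (b <= N.+1)%N ->
       (cell_index R N x < b)%N -> x * N.+2%:R < b%:R].
Proof.
move=> /andP[x0 x1]; rewrite /cell_index inordK ?ltnS ?geq_minr//.
have y0 : 0 <= x * N.+2%:R by rewrite mulr_ge0.
have /andP[ty yt] := truncn_itv y0; split.
- by apply: le_trans ty; rewrite ler_nat geq_minl.
- case: leqP => _; first exact: ltW.
  by rewrite -[leRHS]mul1r ler_wpM2r.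
- move=> b bN; rewrite gtn_min [X in _ || X]ltnNge bN orbF => tb.
  by apply: lt_le_trans yt _; rewrite ler_nat.
Qed.

Section interval_cells.
Local Open Scope classical_set_scope.

Lemma interval_measure_le (R : realType) (I : set R) (u v : R) :
  is_interval I -> I `<=` `[u, v] -> u <= v ->
  (lebesgue_measure I <= (v - u)%:E)%E.
Proof.
move=> Iitv Iuv uv; have : (lebesgue_measure [set` `[u, v]%R] <= (v - u)%:E)%E.
  by rewrite lebesgue_measure_itv /= lte_fin; case: ifP => // _;
    rewrite lee_fin subr_ge0.
apply: le_trans; apply: (le_measure lebesgue_measure _ _ Iuv); rewrite inE.
  exact: measurable_realfun.is_interval_measurable.
exact: measurable_itv.
Qed.

Lemma interval01_measure (R : realType) (I : set R) :
  is_interval I -> I `<=` `[0, 1] ->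
  lebesgue_measure I = (fine (lebesgue_measure I))%:E /\
  0 <= fine (lebesgue_measure I) <= 1.
Proof.
move=> Iitv I01; have := interval_measure_le R I 0 1 Iitv I01 ler01.
have : (0 <= lebesgue_measure I)%E by exact: measure_ge0.
by case: (lebesgue_measure I) => //= r; rewrite !lee_fin subr0 => -> ->.
Qed.

(** Let [a] and [b] be the extreme cells met by [I]. By convexity [I] covers every cell strictly
    between them, and it lies in the union of the cells from [a] to [b]; the [2] pays for these two
    end cells. *)
Lemma interval_slab (R : realType) (N : nat) (I : set R) :
  is_interval I -> I `<=` `[0, 1] ->
  exists s : 'I_N.+2 * 'I_N.+2,
    (lebesgue_measure I <= ((#|slab N s|%:R + 2) / N.+2%:R)%:E)%E /\
    forall g, slab N s g -> forall y : R,
      g.+1%:R <= y * N.+2%:R < g.+2%:R -> I y.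
Proof.
move=> Iitv I01; pose c := cell_index R N.
pose hit := [pred a : 'I_N.+2 | `[< exists2 x, I x & c x = a >]].
have [->|/set0P[x0 Ix0]] := eqVneq I set0.
  exists (ord0, ord0); split; first by rewrite measure0 lee_fin divr_ge0.
  by move=> g /andP[].
have hitc x : I x -> hit (c x) by move=> Ix; apply/asboolP; exists x.
case: (@arg_minnP _ (c x0) hit val (hitc _ Ix0)) => a /asboolP[xa Ia ca] amin.
case: (@arg_maxnP _ (c x0) hit val (hitc _ Ix0)) => b /asboolP[xb Ib cb] bmax.
have cP x : I x -> _ := fun Ix => cell_indexP R N x (I01 x Ix).
have T0 : 0 < N.+2%:R :> R by rewrite ltr0n.
exists (a, b); split.
  have Iab : I `<=` `[a%:R / N.+2%:R, b.+1%:R / N.+2%:R].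
    move=> x Ix; have [cx xc _] := cP x Ix; rewrite /= in_itv /=.
    rewrite ler_pdivrMr// ler_pdivlMr//; apply/andP; split.
      by apply: le_trans cx; rewrite ler_nat; exact: amin (hitc _ Ix).
    by apply: le_trans xc _; rewrite ler_nat ltnS; exact: bmax (hitc _ Ix).
  have ba : (a <= b.+1)%N.
    by rewrite leqW//; apply: amin; apply/asboolP; exists xb.
  apply: le_trans (interval_measure_le _ _ _ _ Iitv Iab _) _.
    by rewrite ler_pM2r ?invr_gt0// ler_nat.
  rewrite lee_fin -mulrBl ler_pM2r ?invr_gt0//.
  rewrite lerBlDr -!natrD ler_nat.
  by have := card_slab_ge N (a, b); rewrite /=; lia.
move=> g /andP[/= ag gb] y /andP[gy yg].
have [_ _ xag] := cP xa Ia; have [bxb _ _] := cP xb Ib.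
apply: (Iitv xa xb) => //; apply/andP; split; rewrite -(ler_pM2r T0).
  apply: le_trans gy; apply/ltW/xag; first by have := ltn_ord g; lia.
  by rewrite -/(c xa) ca; lia.
apply: le_trans (ltW yg) _; apply: le_trans bxb.
by rewrite -/(c xb) cb ler_nat.
Qed.
End interval_cells.

(** * Grid boxes and their encoding *)

Definition grid_box (d N : nat) (s : 'I_d -> 'I_N.+2 * 'I_N.+2) :
    pred {ffun 'I_d -> 'I_N} :=
  [pred x : {ffun _ -> _} | [forall l, slab N (s l) (x l)]].

Lemma card_grid_box d N (s : 'I_d -> 'I_N.+2 * 'I_N.+2) :
  #|grid_box d N s| = (\prod_l #|slab N (s l)|)%N.
Proof.
transitivity #|family (fun l => slab N (s l))|; first exact: eq_card.
by rewrite card_family foldrE big_map big_enum.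
Qed.

(** Each proper slab multiplies the fraction of the grid by at most [1 - 1 / N <= exp (- 1 / N)], so
    a fraction [p] leaves room for few of them. *)
Lemma card_proper_slabs_le (R : realType) d N (s : 'I_d -> 'I_N.+2 * 'I_N.+2)
    (p : R) : (0 < N)%N -> 0 < p -> p * (N ^ d)%:R <= #|grid_box d N s|%:R ->
  #|[pred l | (#|slab N (s l)| < N)%N]|%:R <= N%:R * - ln p.
Proof.
move=> N0 p0; rewrite card_grid_box natr_prod natrX.
have NR : 0 < N%:R :> R by rewrite ltr0n.
set D := [pred l | _]; move=> large.
have : p <= expR (- (#|D|%:R / N%:R)).
  apply: (@le_trans _ _ (\prod_l (#|slab N (s l)|%:R / N%:R))).
    by rewrite prodf_div prodr_const card_ord ler_pdivlMr ?exprn_gt0.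
  rewrite -mulrN expRM_natl -prodr_const [leRHS]big_mkcond /=.
  apply: ler_prod => l _; rewrite divr_ge0//= ler_pdivrMr//.
  case: ifP => [|_]; last first.
    by rewrite mul1r ler_nat -[leqRHS]card_ord max_card.
  rewrite inE => lN.
  apply: (@le_trans _ _ ((1 + - N%:R^-1) * N%:R)).
    by rewrite mulrDl mulNr mulVf ?gt_eqF// mul1r lerBrDr natr1 ler_nat.
  by rewrite ler_pM2r// expR_ge1Dx.
rewrite -ler_ln ?posrE ?expR_gt0// expRK lerNr => h.
by rewrite mulrC -ler_pdivrMr.
Qed.

(* Only the proper slabs need to be recorded; unused entries of [j] repeat the
   constraint of coordinate [0]. *)
Lemma grid_box_encode d N A (s : 'I_d -> 'I_N.+2 * 'I_N.+2) :
  (0 < d)%N -> (#|[pred l | (#|slab N (s l)| < N)%N]| <= A)%N ->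
  exists j : {ffun 'I_A -> 'I_d * ('I_N.+2 * 'I_N.+2)},
    grid_box d N s =1
    [pred x : {ffun _ -> _} | [forall i, slab N (j i).2 (x (j i).1)]].
Proof.
case: d s => // d s _; set D := [pred l | _] => DA.
pose l_ (i : 'I_A) := nth ord0 (enum D) i.
exists [ffun i => (l_ i, s (l_ i))] => x /=.
apply/forallP/forallP => h l; first by rewrite ffunE; exact: h.
have [lD|] := boolP (l \in D).
  have lA : (index l (enum D) < A)%N.
    by apply: leq_trans DA; rewrite cardE index_mem mem_enum.
  by have := h (Ordinal lA); rewrite ffunE /l_ /= nth_index// mem_enum.
rewrite inE -leqNgt => full.
have /subset_cardP : #|slab N (s l)| = #|'I_N|.
  by apply/eqP; rewrite eqn_leq max_card card_ord.
by move=> /(_ (subset_predT _)) /(_ (x l)); rewrite !inE.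
Qed.

(** * The sample and its dispersion *)

(* The offset [i / n] inside the cell makes the points distinct even when the
   same grid cell is drawn twice. *)
Definition sample_point (R : realType) (d N n : nat)
    (g : 'I_n -> {ffun 'I_d -> 'I_N}) (i : 'I_n) : d.-tuple R :=
  [tuple ((g i l).+1%:R + i%:R / n%:R) / N.+2%:R | l < d].

Section sample.
Local Open Scope classical_set_scope.
Variables (R : realType) (d N n : nat) (g : 'I_n -> {ffun 'I_d -> 'I_N}).
Let P := range (sample_point R d N n g).

Let offset_itv (i : 'I_n) : 0 <= (i%:R / n%:R : R) < 1.
Proof.
have n0 : 0 < n%:R :> R by rewrite ltr0n (leq_trans _ (ltn_ord i)).
by rewrite divr_ge0//= ltr_pdivrMr// mul1r ltr_nat.
Qed.

Lemma sample_point_inj : (0 < d)%N -> injective (sample_point R d N n g).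
Proof.
move=> d0 i i' /(congr1 (fun x => tnth x (Ordinal d0))).
have n0 : 0 < n%:R :> R by rewrite ltr0n (leq_trans _ (ltn_ord i)).
rewrite !tnth_mktuple => /(mulIf _).
rewrite invr_eq0 pnatr_eq0 => /(_ isT) /(congr1 (fun y => y * n%:R)).
(* Scaled by [n], the coordinates become integers congruent to [i] and [i'] modulo [n]. *)
rewrite !mulrDl !divfK ?gt_eqF// -!natrM -!natrD.
move=> /eqP; rewrite eqr_nat => /eqP /(congr1 (modn ^~ n)).
by rewrite !modnMDl !modn_small// => /val_inj.
Qed.

Lemma sample_sub_cube : P `<=` @cube R d.
Proof.
move=> _ [i _ <-] l; rewrite tnth_mktuple; have /andP[u0 u1] := offset_itv i.
have T0 : 0 < N.+2%:R :> R by rewrite ltr0n.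
apply/andP; split.
  by apply: divr_ge0 (ltW T0); apply: addr_ge0 u0.
rewrite ler_pdivrMr// mul1r -[N.+2%:R]natr1 lerD ?(ltW u1)//.
by rewrite ler_nat ltnS ltnW.
Qed.

Lemma card_sample : (0 < d)%N -> (P #= `I_n)%card.
Proof.
move=> d0; apply: card_eq_trans (card_esym card_II).
by apply: inj_card_eq => i j _ _; exact: sample_point_inj.
Qed.

Lemma card_sample_inter (B : set (d.-tuple R)) (Q : pred 'I_n) k : (0 < d)%N ->
  (forall i, Q i -> B (sample_point R d N n g i)) -> (P `&` B #<= `I_k)%card ->
  (#|Q| <= k)%N.
Proof.
move=> d0 QB Bk; rewrite -card_le_II; apply: card_le_trans Bk.
pose h (j : 'I_#|Q|) := sample_point R d N n g (enum_val j).
have hB : range h `<=` P `&` B.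
  by move=> _ [j _ <-]; split; [exists (enum_val j)|exact/QB/(enum_valP j)].
apply: card_le_trans (subset_card_le hB).
have /card_eqPle[_ //] : (range h #= `I_#|Q|)%card.
apply: card_eq_trans (card_esym card_II).
by apply: inj_card_eq => i j _ _ /(sample_point_inj d0) /enum_val_inj.
Qed.

Lemma kdisp_sample_le k (eps : R) : (0 < d)%N -> 0 < eps -> 4 / eps <= N%:R ->
  (forall s, eps / 2 * (N ^ d)%:R <= #|grid_box d N s|%:R ->
     (k < #|[pred i | grid_box d N s (g i)]|)%N) ->
  (kdisp k P <= eps%:E)%E.
Proof.
move=> d0 e0 Ne rich; apply: ge_ereal_sup => _ [B [[I Iitv <-{B}] Bk] <-].
have NR : 0 < N%:R :> R by apply: lt_le_trans Ne; rewrite divr_gt0.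
have mI l : measurable (I l : set (measurableTypeR R)).
  by have [h _] := Iitv l; exact: measurable_realfun.is_interval_measurable.
have := fun l => interval_slab R N (I l) (Iitv l).1 (Iitv l).2.
move=> /choice[s sP].
have leb01 l := interval01_measure R (I l) (Iitv l).1 (Iitv l).2.
rewrite vol_box// leNgt; apply/negP.
under eq_bigr do rewrite (leb01 _).1.
rewrite prodEFin lte_fin => Vgt.
have frac l : fine (lebesgue_measure (I l)) -
    2 / N%:R * (1 - fine (lebesgue_measure (I l))) <= #|slab N (s l)|%:R / N%:R.
  have := (sP l).1; rewrite (leb01 _).1 lee_fin ler_pdivlMr ?ltr0n//.
  move: (fine _) => u; rewrite -addn2 natrD => h.
  rewrite ler_pdivlMr//.
  have -> : (u - 2 / N%:R * (1 - u)) * N%:R = u * N%:R - 2 * (1 - u).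
    by field; rewrite gt_eqF.
  by move: h; lra.
have N2 : 2 / N%:R <= eps / 2.
  move: Ne; rewrite !ler_pdivrMr// => Ne; lra.
have h : eps / 2 <= \prod_l (#|slab N (s l)|%:R / N%:R).
  apply: le_trans (prod_shrink_ge _ _ (2 / N%:R) _ _ _
    (fun l => (leb01 l).2) _ frac); last 2 first.
  - by rewrite divr_ge0.
  - by move=> l; rewrite divr_ge0.
  have : 0 <= 2 / N%:R :> R by rewrite divr_ge0.
  move: Vgt N2; set V := \prod_(_ | _) _; set t := 2 / _ => Vgt N2 t0; nra.
have {h} : eps / 2 * (N ^ d)%:R <= #|grid_box d N s|%:R.
  rewrite card_grid_box natr_prod natrX.
  have -> : \prod_i #|slab N (s i)|%:R =
      (\prod_i (#|slab N (s i)|%:R / N%:R)) * N%:R ^+ d :> R.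
    by rewrite prodf_div prodr_const card_ord divfK// gt_eqF ?exprn_gt0.
  by rewrite ler_pM2r ?exprn_gt0.
move=> /rich; rewrite ltnNge => /negP; apply.
apply: card_sample_inter d0 _ Bk => i /forallP gs l.
apply: (sP l).2 (gs l) _ _; rewrite tnth_mktuple divfK ?pnatr_eq0//.
have /andP[u0 u1] := offset_itv i.
by rewrite lerDl u0/= -[ltRHS]natr1 ltrD2l.
Qed.

End sample.

(** * Bounds on the minimal dispersion *)

Lemma min_kdisp_sample_le (R : realType) d N n (g : 'I_n -> {ffun 'I_d -> 'I_N})
    k :
  (0 < d)%N ->
  (min_kdisp R k n d <= kdisp k (range (sample_point R d N n g)))%E.
Proof.
move=> d0; apply: ge_ereal_inf.
exists (kdisp k (range (sample_point R d N n g))).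
  exists (range (sample_point R d N n g)) => //; split.
    exact: sample_sub_cube.
  exact: card_sample.
exact: lexx.
Qed.

Lemma kdisp_le1 (R : realType) k d (P : set (d.-tuple R)) : (kdisp k P <= 1)%E.
Proof.
apply: ge_ereal_sup => _ [_ [[I Iitv <-] _] <-].
rewrite vol_box; last first.
  move=> l; have [h _] := Iitv l.
  exact: measurable_realfun.is_interval_measurable.
have leb01 l := interval01_measure R (I l) (Iitv l).1 (Iitv l).2.
under eq_bigr do rewrite (leb01 _).1.
by rewrite prodEFin lee_fin; apply: prodr_ile1 => l _; exact: (leb01 l).2.
Qed.

Lemma min_kdisp_le1 (R : realType) k n d :
  (0 < d)%N -> (min_kdisp R k n d <= 1)%E.
Proof.
move=> d0; apply: le_trans (kdisp_le1 _ _ _ _).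
(* Any [n]-point set serves; here all points lie in a single grid cell and differ by their
   offsets. *)
exact: (min_kdisp_sample_le _ _ 1 _ (fun=> [ffun=> ord0])).
Qed.

(** The union bound runs over codes of [A] pairs (coordinate, slab), each pair having
    [d (N + 2) ^ 2] possible values. *)
Lemma min_kdisp_le_of_count (R : realType) d k n N A (eps : R) :
  (0 < d)%N -> 0 < eps -> 4 / eps <= N%:R -> N%:R * - ln (eps / 2) <= A%:R ->
  (d * (N.+2 * N.+2))%:R ^+ A * 2 ^+ k * (1 - eps / 4) ^+ n < 1 ->
  (min_kdisp R k n d <= eps%:E)%E.
Proof.
move=> d0 e0 Ne NA small.
have N0 : (0 < N)%N.
  by rewrite -(ltr0n R); apply: lt_le_trans Ne; rewrite divr_gt0.
pose J := {ffun 'I_A -> 'I_d * ('I_N.+2 * 'I_N.+2)}.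
pose B (j : J) :=
  [pred x : {ffun 'I_d -> 'I_N} | [forall i, slab N (j i).2 (x (j i).1)]].
have [||g gP] := exists_rich_sample R {ffun 'I_d -> 'I_N} J B (eps / 2) n k.
- by rewrite card_ffun !card_ord expn_gt0 N0.
- rewrite card_ffun !card_prod !card_ord natrX.
  by have -> : eps / 2 / 2 = eps / 4 by field.
apply: le_trans (min_kdisp_sample_le R d N n g k d0) _.
apply: kdisp_sample_le => // s large.
have [|j jE] := grid_box_encode d N A s d0.
  rewrite -(ler_nat R); apply: le_trans NA.
  by apply: card_proper_slabs_le large; rewrite ?divr_gt0.
have := gP j; rewrite card_ffun !card_ord -(eq_card jE) => /(_ large).
by rewrite (eq_card (fun i => jE (g i))).
Qed.

(** * Choice of parameters *)

Lemma log2_ge1 (R : realType) (x : R) : 2 <= x -> 1 <= log2 x.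
Proof.
move=> x2; rewrite /log2 ler_pdivlMr ?ln_gt0 ?ltr1n// mul1r.
by rewrite ler_ln ?posrE//; apply: lt_le_trans x2.
Qed.

Lemma ln_le_log2 (R : realType) (x : R) : 1 <= x -> ln x <= log2 x.
Proof.
move=> x1; rewrite /log2 ler_pdivlMr ?ln_gt0 ?ltr1n//.
have : ln (2 : R) <= 1 by have := @le_ln1Dx R 1; apply; lra.
have := ln_ge0 x1; nra.
Qed.

(** In logarithms, the counting condition follows from [A (ln d + ln n) + k < eps n / 4]. With [N]
    of order [1 / eps] and [A <= 6 L / eps], the two terms on the left are at most [12 / 256] and
    [16 / 256] of [eps n]. *)
Lemma min_kdisp_le_of_large (R : realType) (d k n : nat) (eps : R) :
  (2 <= d)%N -> (2 <= n)%N -> 0 < eps < 1 ->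
  256 * (log2 n%:R ^+ 2 * log2 d%:R) <= eps ^+ 2 * n%:R ->
  16 * k%:R <= eps * n%:R ->
  (min_kdisp R k n d <= eps%:E)%E.
Proof.
move=> d2 n2 /andP[e0 e1] big_d big_k.
have d2R : 2 <= d%:R :> R by rewrite ler_nat.
have n2R : 2 <= n%:R :> R by rewrite ler_nat.
have D1 := log2_ge1 R _ d2R; have L1 := log2_ge1 R _ n2R.
have lnd : ln d%:R <= log2 d%:R :> R by apply: ln_le_log2; lra.
have lnn : ln n%:R <= log2 n%:R :> R by apply: ln_le_log2; lra.
move: (log2 d%:R) (log2 n%:R) big_d D1 L1 lnd lnn => D L big_d D1 L1 lnd lnn.
have L2 : 1 <= L ^+ 2 by rewrite expr_ge1//; lra.
have LD : 1 <= L ^+ 2 * D by nra.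
have [N [Nlo Nhi]] : exists N : nat, 4 / eps <= N%:R /\ N%:R <= 5 / eps.
  have pos : 0 <= 4 / eps by rewrite divr_ge0// ltW.
  have /andP[lo hi] := truncn_itv pos.
  exists (Num.truncn (4 / eps)).+1; split; first exact: ltW.
  rewrite -natr1; apply: (@le_trans _ _ (4 / eps + 1)); first by rewrite lerD2r.
  rewrite -lerBrDl -mulrBl ler_pdivlMr//; lra.
(* [(N + 2) ^ 2 <= 49 / eps ^ 2], while [big_d] and [LD] give [n >= 256 / eps ^ 2]. *)
have N2n : (N.+2 * N.+2)%:R <= n%:R :> R.
  have : N.+2%:R <= 7 / eps.
    rewrite -addn2 natrD; apply: le_trans (lerD Nhi (lexx _)) _.
    rewrite -lerBrDl -mulrBl ler_pdivlMr//; lra.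
  rewrite ler_pdivlMr// natrM; have : 0 < N.+2%:R :> R by rewrite ltr0n.
  move: (N.+2%:R : R) => u u0 ue.
  have u49 : (u * eps) * (u * eps) <= 7 * 7.
    by apply: ler_pM => //; rewrite mulr_ge0 ?ltW.
  have e2 : 0 < eps ^+ 2 by rewrite exprn_gt0.
  rewrite -(ler_pM2l e2); lra.
have lne : - ln (eps / 2) <= ln n%:R.
  rewrite -lnV ?posrE ?divr_gt0// ler_ln ?posrE ?invr_gt0 ?divr_gt0//; last lra.
  rewrite invf_div ler_pdivrMr//; nra.
have lne0 : 0 <= - ln (eps / 2) by rewrite oppr_ge0 ln_le0; lra.
have [A [Alo Ahi]] : exists A : nat,
    N%:R * - ln (eps / 2) <= A%:R /\ A%:R <= 6 / eps * L.
  have pos : 0 <= N%:R * - ln (eps / 2) by rewrite mulr_ge0.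
  have /andP[lo hi] := truncn_itv pos.
  (* Rounding up costs 1, which is at most [L / eps]; hence 6 in place of 5. *)
  exists (Num.truncn (N%:R * - ln (eps / 2))).+1; split; first exact: ltW.
  rewrite -natr1.
  apply: (@le_trans _ _ (5 / eps * L + 1 / eps * L)); last by lra.
  apply: lerD; first by apply: le_trans lo _; apply: ler_pM => //; lra.
  by rewrite mul1r mulrC ler_pdivlMr//; nra.
have d0 : (0 < d)%N := ltnW d2.
apply: (min_kdisp_le_of_count R d k n N A _ d0 e0 Nlo Alo).
have dn : (d * (N.+2 * N.+2))%:R <= expR (ln d%:R + ln n%:R) :> R.
  rewrite expRD !lnK ?posrE; [|lra|lra].
  by rewrite natrM ler_pM2l//; lra.
have two : 2 <= expR 1 :> R by have := expR_ge1Dx (1 : R); lra.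
have miss : 1 - eps / 4 <= expR (- (eps / 4)) by exact: expR_ge1Dx.
apply: (@le_lt_trans _ _ (expR (A%:R * (ln d%:R + ln n%:R)) * expR (k%:R * 1) *
    expR (n%:R * - (eps / 4)))).
  rewrite !expRM_natl; apply: ler_pM; last 2 first.
  - by apply: ler_pM; rewrite ?exprn_ge0// lerXn2r ?nnegrE ?expR_ge0.
  - by rewrite lerXn2r ?nnegrE ?expR_ge0//; lra.
  - by rewrite mulr_ge0 ?exprn_ge0.
  - by rewrite exprn_ge0//; lra.
rewrite -!expRD -[ltRHS]expR0 ltr_expR.
have : A%:R * (ln d%:R + ln n%:R) <= (6 / eps * L) * (2 * (L * D)).
  have : 0 <= ln d%:R :> R by apply: ln_ge0; lra.
  have : 0 <= ln n%:R :> R by apply: ln_ge0; lra.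
  move=> ? ?; apply: ler_pM => //; nra.
have -> : 6 / eps * L * (2 * (L * D)) = 12 * (L ^+ 2 * D) / eps by field; lra.
have : 12 * (L ^+ 2 * D) / eps <= 12 / 256 * (eps * n%:R).
  rewrite ler_pdivrMr//; lra.
have : 0 < eps * n%:R by apply: mulr_gt0 => //; lra.
lra.
Qed.

Theorem theorem1 (R : realType) :
  exists C : R, 0 < C /\
    forall d k n : nat, (2 <= d)%N -> (0 < k)%N -> (0 < n)%N ->
      k%:R < n%:R / 2 :> R ->
      (min_kdisp R k n d <=
        (C * Num.max (log2 n%:R * Num.sqrt (log2 d%:R / n%:R))
                     (k%:R * (log2 (n%:R / k%:R) / n%:R)))%:E)%E.
Proof.
(* [16] matches both constants of [min_kdisp_le_of_large], as [256 = 16 ^ 2]. *)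
exists 16; split=> // d k n d2 k0 n0 kn.
have n0R : 0 < n%:R :> R by rewrite ltr0n.
have k1R : 1 <= k%:R :> R by rewrite ler1n.
have n2 : (2 <= n)%N by rewrite -(ler_nat R); lra.
have D1 : 1 <= log2 d%:R :> R by apply: log2_ge1; rewrite ler_nat.
have L1 : 1 <= log2 n%:R :> R by apply: log2_ge1; rewrite ler_nat.
have K1 : 1 <= log2 (n%:R / k%:R) :> R.
  by apply: log2_ge1; rewrite ler_pdivlMr; lra.
set a := (X in Num.max X _); set b := (X in Num.max _ X).
set eps := 16 * _.
have ea : 16 * a <= eps by rewrite ler_pM2l// le_max lexx.
have eb : 16 * b <= eps by rewrite ler_pM2l// le_max lexx orbT.
have [e1|e1] := leP 1 eps.
  by apply: le_trans (min_kdisp_le1 _ _ _ _ _) _; [exact: ltnW|rewrite lee_fin].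
have bE : b * n%:R = k%:R * log2 (n%:R / k%:R).
  by rewrite /b -mulrA divfK// gt_eqF.
have b0 : 0 < b by rewrite -(pmulr_lgt0 _ n0R) bE; nra.
have a0 : 0 <= a by rewrite mulr_ge0 ?sqrtr_ge0//; lra.
have a2 : a ^+ 2 * n%:R = log2 n%:R ^+ 2 * log2 d%:R.
  rewrite /a exprMn sqr_sqrtr; last by rewrite divr_ge0//; lra.
  by rewrite -mulrA divfK// gt_eqF.
apply: min_kdisp_le_of_large => //.
- by apply/andP; split=> //; lra.
- rewrite -a2 mulrA ler_pM2r//; nra.
(* Since [k < n / 2], [log2 (n / k) >= 1] and so [b * n] dominates [k]. *)
- apply: le_trans (_ : 16 * b * n%:R <= _); last by rewrite ler_pM2r.
  rewrite -mulrA bE; nra.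
Qed.
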